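(* Let $N\ge 1$ be an integer, let $a\ge 1$ be an integer coprime to $N$, and let $b$ be the integer with $1\le b<N+a$ and $ab\equiv 1\pmod{N+a}$. If $r=b+i(N+a)$ is prime for some integer $i\ge 2$, then $\mathcal{X}(N,r,N+a)$ consists of all positive values, i.e. $[\mathcal{X}(N,r,N+a)]>0$.
   Context: For integers $N,r\ge 1$ and a positive divisor $f$ of $Nr+1$, define $$\mathcal{X}(N,r,f)=\Big\{(x+y)-\Big(f+\tfrac{Nr+1}{f}\Big): x,y \text{ positive integers with } xy=Nr\Big\},$$ a finite set of integers. The notation $[\mathcal{X}(N,r,f)]>0$ means that $f$ divides $Nr+1$ and every element of $\mathcal{X}(N,r,f)$ is a positive integer. *)

(* Defs.v *)
From mathcomp Require Import all_boot all_order all_algebra.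
From mathcomp Require Import classical_sets.

Set Implicit Arguments.
Unset Strict Implicit.
Unset Printing Implicit Defensive.

Import Order.TTheory GRing.Theory Num.Theory.

Local Open Scope classical_set_scope.
Local Open Scope ring_scope.

(* The arguments are natural numbers, but the outer subtraction is that of     *)
(* int, so the elements may be negative.  The quotient by f is meaningful only *)
(* when f divides N * r + 1, which calX_pos requires.                          *)
Definition calX (N r f : nat) : set int :=
  [set z | exists x y : nat,
     [/\ (0 < x)%N, (0 < y)%N, (x * y = N * r)%N &
         z = (x + y)%N%:Z - (f + (N * r + 1) %/ f)%N%:Z]].

Definition calX_pos (N r f : nat) : Prop :=
  (f %| N * r + 1)%N /\ (forall z : int, calX N r f z -> 0 < z).

(* Main.v *)
Require Import Defs.
From mathcomp Require Import all_boot all_order all_algebra.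
From mathcomp Require Import classical_sets.
From mathcomp Require Import zify.

(** Since [N = -a] and [r = b] modulo [f = N + a], we get [N r + 1 = 0] modulo
    [f].  As [r] is prime, a factorization of [N r] is, up to order,
    [(r d) * e] with [d e = N], and [r d + e - (r + N) = (d - 1) (r - e) >= 0],
    so it is enough to treat [r + N].  There the claim [r + N > f + (N r + 1) / f]
    amounts, after multiplication by [f], to [a (r - f) > 1]. *)

Lemma dvdn_mulS_of_inverse (N a b i : nat) :
  a * b = 1 %[mod N + a] -> N + a %| N * (b + i * (N + a)) + 1.
Proof.
move=> hab.
have -> : N * (b + i * (N + a)) + 1 = N * b + 1 + (N * i) * (N + a) by nia.
rewrite dvdn_addl ?dvdn_mull //.
(* Trading [1] for [a * b] makes the sum a multiple of [N + a]. *)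
have: N * b + 1 = (N + a) * b %[mod N + a] by rewrite -modnDmr -hab modnDmr -mulnDl.
by rewrite modnMr => /eqP.
Qed.

Lemma prime_mul_add_ge (N r x y : nat) :
  prime r -> 0 < N <= r -> x * y = N * r -> r + N <= x + y.
Proof.
move=> pr /andP[N0 Nr].
wlog /dvdnP[d ->] : x y / r %| x => [th xy|xy].
  have: r %| x * y by rewrite xy dvdn_mull.
  rewrite Euclid_dvdM // => /orP[rx|ry]; first exact: th.
  by rewrite (addnC x); apply: th => //; rewrite mulnC.
have r0 := prime_gt0 pr.
have dy : d * y = N by apply/eqP; rewrite -(eqn_pmul2r r0) mulnAC xy.
(* Positivity of [d] keeps [d - 1] below from truncating. *)
have d0 : 0 < d by case: (d) dy => // y0; rewrite -y0 in N0.
have y_le : y <= r by apply: leq_trans Nr; rewrite -dy leq_pmull.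
have : (d - 1) * y <= (d - 1) * r by rewrite leq_mul.
by rewrite !mulnBl !mul1n; nia.
Qed.

(** This is [(N + a) + q < r + N] with [N] cancelled. *)
Lemma quotient_lt (N a r q : nat) :
  0 < a -> 2 * (N + a) < r -> N * r + 1 = q * (N + a) -> a + q < r.
Proof.
(* The negated goal times [N + a] gives [a * r <= a * (N + a) + 1], too small for
   [r > 2 * (N + a)]. *)
move=> a0 r_gt qE; rewrite ltnNge; apply/negP => /(leq_mul (leqnn (N + a))).
have := leq_mul (leqnn a) r_gt.
have : 0 < a * (N + a) by rewrite muln_gt0 addn_gt0 a0 orbT.
by move: qE a0; clear; lia.
Qed.

Theorem lemma6p1 (N a b r i : nat)
    (hN : 0 < N) (ha : 0 < a) (hcop : coprime a N)
    (hb : 1 <= b < N + a) (hab : a * b = 1 %[mod N + a])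
    (hi : 2 <= i) (hr : r = b + i * (N + a)) (hprime : prime r) :
  calX_pos N r (N + a).
Proof.
have fdvd : N + a %| N * r + 1 by rewrite hr dvdn_mulS_of_inverse.
split=> // z [x [y [_ _ xy ->]]].
have [q qE] := dvdnP fdvd.
rewrite qE mulnK ?addn_gt0 ?hN //.
have r_gt : 2 * (N + a) < r.
  rewrite hr; case/andP: hb => b_gt0 _.
  (* The strictness comes from [1 <= b], the factor 2 from [hi]. *)
  by rewrite -add1n leq_add // leq_mul.
have N_le_r : 0 < N <= r by rewrite hN /=; move: r_gt; clear; lia.
have rN_le := prime_mul_add_ge _ _ _ _ hprime N_le_r xy.
have q_lt := quotient_lt _ _ _ _ ha r_gt qE.
by move: rN_le q_lt; clear; lia.
Qed.
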